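(* Let $P(z)\in\mathbb{C}[[z]]$ with $o(P(z))\ge 2$ be Hessian nilpotent and let $Q_t(z)$ be its deformed inversion pair. Then for every $k\ge 1$, $$Q_t^k(z)=k!\sum_{m=0}^\infty\frac{t^m}{2^m\,m!\,(m+k)!}\,\Delta^mP^{m+k}(z).$$ In particular, writing $Q_t(z)=\sum_{m=1}^\infty t^{m-1}Q_{[m]}(z)$ with $Q_{[m]}(z)\in\mathbb{C}[[z]]$, for every $m\ge 1$, $$Q_{[m]}(z)=\frac{1}{2^{m-1}\,m!\,(m-1)!}\,\Delta^{m-1}P^m(z).$$
   Context: Here $z=(z_1,\dots,z_n)$, $t$ is a formal parameter commuting with $z$, $\Delta=\sum_{i=1}^n \partial^2/\partial z_i^2$, and $o(\cdot)$ denotes the order with respect to $z$ (lowest degree in $z$ of a monomial occurring). $P$ is Hessian nilpotent if its Hessian matrix $\left(\frac{\partial^2 P}{\partial z_i\partial z_j}\right)$ is nilpotent. For $P\in\mathbb{C}[[z]]$ with $o(P)\ge 2$, the deformed inversion pair of $P$ is the unique $Q_t(z)\in\mathbb{C}[[z,t]]$ with $o(Q_t(z))\ge 2$ such that $z+t\nabla Q_t(z)$ is the formal (compositional, in $z$) inverse of $z-t\nabla P(z)$, where $\nabla$ is the gradient in $z$. *)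

(* Defs.v *)
From HB Require Import structures.
From mathcomp Require Import all_boot all_order all_algebra.
From mathcomp Require Import complex.
From mathcomp Require Import boolp reals.
From mathcomp Require Import mpoly.

Set Implicit Arguments.
Unset Strict Implicit.
Unset Printing Implicit Defensive.

Import GRing.Theory.
Local Open Scope ring_scope.

(* Formal power series in n commuting variables over K: arbitrary families of
   coefficients indexed by the exponents 'X_{1..n}. *)
Record fps (n : nat) (K : Type) := Fps { fpscoef :> 'X_{1..n} -> K }.

Notation "{ 'fps' K [ n ] }" := (fps n K)
  (at level 0, K at level 2, n at level 2, format "{ 'fps'  K [ n ] }").

Section Ring.
Variables (n : nat) (K : comNzRingType).
Implicit Types (f g h : {fps K[n]}) (m : 'X_{1..n}).

Lemma fpsP f g : (forall m, f m = g m) -> f = g.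
Proof. by case: f g => [f] [g] /= fg; congr Fps; apply: funext. Qed.

HB.instance Definition _ := gen_eqMixin {fps K[n]}.
HB.instance Definition _ := gen_choiceMixin {fps K[n]}.

Definition fps_zero : {fps K[n]} := Fps (fun=> 0).
Definition fps_opp f : {fps K[n]} := Fps (fun m => - f m).
Definition fps_add f g : {fps K[n]} := Fps (fun m => f m + g m).
Definition fps_one : {fps K[n]} := Fps (fun m => (m == 0%MM)%:R).
Definition fps_mul f g : {fps K[n]} := Fps (fun m =>
  \sum_(k : 'X_{1..n < (mdeg m).+1, (mdeg m).+1} | m == (k.1 + k.2)%MM)
     f k.1 * g k.2).
Definition fps_scale (c : K) f : {fps K[n]} := Fps (fun m => c * f m).

Fact fps_addA : associative fps_add.
Proof. by move=> f g h; apply: fpsP => m /=; rewrite addrA. Qed.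
Fact fps_addC : commutative fps_add.
Proof. by move=> f g; apply: fpsP => m /=; rewrite addrC. Qed.
Fact fps_add0 : left_id fps_zero fps_add.
Proof. by move=> f; apply: fpsP => m /=; rewrite add0r. Qed.
Fact fps_addN : left_inverse fps_zero fps_opp fps_add.
Proof. by move=> f; apply: fpsP => m /=; rewrite addNr. Qed.

HB.instance Definition _ := GRing.isZmodule.Build {fps K[n]}
  fps_addA fps_addC fps_add0 fps_addN.

Definition fps_trunc d f : {mpoly K[n]} :=
  \sum_(m : 'X_{1..n < d}) f m *: 'X_[m].

Lemma fps_truncE d f m : (mdeg m < d)%N -> (fps_trunc d f)@_m = f m.
Proof. exact: mcoeff_mpoly. Qed.

Lemma fps_mul_trunc d f p g q m : (mdeg m < d)%N ->
  (forall a, (mdeg a < d)%N -> p@_a = f a) ->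
  (forall a, (mdeg a < d)%N -> q@_a = g a) ->
  fps_mul f g m = (p * q)@_m.
Proof.
move=> md pf qg; rewrite mcoeffM /=; apply: eq_bigr => -[a b] _ /=.
by rewrite pf ?qg //; apply: leq_trans (bmdeg _) _.
Qed.

Fact fps_mulA : associative fps_mul.
Proof.
move=> f g h; apply: fpsP => m; pose d := (mdeg m).+1.
have tr u a : (mdeg a < d)%N -> (fps_trunc d u)@_a = u a by exact: fps_truncE.
rewrite (@fps_mul_trunc d _ (fps_trunc d f) _ (fps_trunc d g * fps_trunc d h))
  ?ltnS //; last 2 first.
- exact: tr.
- by move=> a ad; apply/esym/(fps_mul_trunc ad); exact: tr.
rewrite mulrA.
rewrite (@fps_mul_trunc d _ (fps_trunc d f * fps_trunc d g) _ (fps_trunc d h))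
  ?ltnS //; last 2 first.
- by move=> a ad; apply/esym/(fps_mul_trunc ad); exact: tr.
- exact: tr.
Qed.

Fact fps_mulC : commutative fps_mul.
Proof.
move=> f g; apply: fpsP => m; pose d := (mdeg m).+1.
have tr u a : (mdeg a < d)%N -> (fps_trunc d u)@_a = u a by exact: fps_truncE.
have md : (mdeg m < d)%N by [].
by rewrite (fps_mul_trunc md (tr f) (tr g)) (fps_mul_trunc md (tr g) (tr f)) mulrC.
Qed.

Fact fps_mul1 : left_id fps_one fps_mul.
Proof.
move=> f; apply: fpsP => m; pose d := (mdeg m).+1.
rewrite (@fps_mul_trunc d _ 1 _ (fps_trunc d f)) //; last 2 first.
- by move=> a _; rewrite mcoeff1.
- exact: fps_truncE.
by rewrite mul1r fps_truncE.
Qed.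

Fact fps_mulDl : left_distributive fps_mul +%R.
Proof.
move=> f g h; apply: fpsP => m /=; rewrite -big_split /=.
by apply: eq_bigr => k _; rewrite mulrDl.
Qed.

Fact fps_one_neq0 : fps_one != 0.
Proof.
apply/eqP => /(congr1 (fun f : {fps K[n]} => f 0%MM)) /= /eqP.
by rewrite eqxx oner_eq0.
Qed.

HB.instance Definition _ := GRing.Zmodule_isComNzRing.Build {fps K[n]}
  fps_mulA fps_mulC fps_mul1 fps_mulDl fps_one_neq0.

Fact fps_scaleA a b f : fps_scale a (fps_scale b f) = fps_scale (a * b) f.
Proof. by apply: fpsP => m /=; rewrite mulrA. Qed.
Fact fps_scale1 : left_id 1 fps_scale.
Proof. by move=> f; apply: fpsP => m /=; rewrite mul1r. Qed.
Fact fps_scaleDr : right_distributive fps_scale +%R.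
Proof. by move=> c f g; apply: fpsP => m /=; rewrite mulrDr. Qed.
Fact fps_scaleDl f : {morph fps_scale^~ f : a b / a + b}.
Proof. by move=> a b; apply: fpsP => m /=; rewrite mulrDl. Qed.

HB.instance Definition _ := GRing.Zmodule_isLmodule.Build K {fps K[n]}
  fps_scaleA fps_scale1 fps_scaleDr fps_scaleDl.

Fact fps_scaleAl (c : K) f g : c *: (f * g) = (c *: f) * g.
Proof.
apply: fpsP => m /=; rewrite mulr_sumr.
by apply: eq_bigr => k _; rewrite mulrA.
Qed.

HB.instance Definition _ := GRing.Lmodule_isLalgebra.Build K {fps K[n]}
  fps_scaleAl.
HB.instance Definition _ := GRing.Lalgebra_isComAlgebra.Build K {fps K[n]}.

End Ring.

Section Calculus.
Variables (n : nat) (K : comNzRingType).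
Implicit Types (f g : {fps K[n]}) (m : 'X_{1..n}).

Definition fps_var (i : 'I_n) : {fps K[n]} := Fps (fun m => (m == U_(i)%MM)%:R).

Definition fps_deriv (i : 'I_n) f : {fps K[n]} :=
  Fps (fun m => f (m + U_(i))%MM *+ (m i).+1).

(* o(f) >= d; in particular it holds for f = 0, whose order is infinite. *)
Definition fps_order_ge (d : nat) f := forall m, f m != 0 -> (d <= mdeg m)%N.

(* Convergence in the formal sense: every coefficient of the partial sums is
   eventually equal to the corresponding coefficient of S. *)
Definition fps_has_sum (a : nat -> {fps K[n]}) (S : {fps K[n]}) :=
  forall m, exists N, forall k, (N <= k)%N -> (\sum_(j < k) a j) m = S m.

Definition laplacian f := \sum_(i < n) fps_deriv i (fps_deriv i f).

Definition hessian f : 'M[{fps K[n]}]_n :=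
  \matrix_(i, j) fps_deriv i (fps_deriv j f).

Definition hessian_nilpotent f := exists N : nat, hessian f ^+ N = 0.

End Calculus.

(* f(F_1, ..., F_n).  This is the usual substitution when no F_i has a constant
   term: then F^a has order at least |a|, so that only the exponents a with
   |a| <= |m| contribute to the coefficient of exponent m.  It is meaningless
   otherwise. *)
Definition fps_comp (n p : nat) (K : comNzRingType)
    (f : {fps K[n]}) (F : 'I_n -> {fps K[p]}) : {fps K[p]} :=
  Fps (fun m =>
    (\sum_(a : 'X_{1..n < (mdeg m).+1}) f a *: \prod_(i < n) F i ^+ a i) m).

(* K[[z, t]], with z = (z_1, ..., z_n), is {fps K[n.+1]}; t is the last
   variable. *)
Section Deformation.
Variables (n : nat) (K : comNzRingType).
Implicit Types (f g : {fps K[n.+1]}) (P : {fps K[n]}).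

Definition zidx (i : 'I_n) : 'I_n.+1 := widen_ord (leqnSn n) i.

Definition zvar (i : 'I_n) : {fps K[n.+1]} := fps_var K (zidx i).
Definition tvar : {fps K[n.+1]} := fps_var K ord_max.

(* The inclusion of K[[z]] in K[[z, t]]. *)
Definition fps_widen P : {fps K[n.+1]} := Fps (fun m =>
  if m ord_max == 0%N then P [multinom m (zidx i) | i < n] else 0).

Definition zgrad f (i : 'I_n) : {fps K[n.+1]} := fps_deriv (zidx i) f.

Definition fps_zorder_ge (d : nat) f :=
  forall m, f m != 0 -> (d <= \sum_(i < n) m (zidx i))%N.

(* f(G(z, t), t): substitution for z, with t left unchanged. *)
Definition zcomp f (G : 'I_n -> {fps K[n.+1]}) : {fps K[n.+1]} :=
  fps_comp f (fun j => if unlift ord_max j is Some i then G i else tvar).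

Definition zinverse (F G : 'I_n -> {fps K[n.+1]}) :=
  (forall i, zcomp (F i) G = zvar i) /\ (forall i, zcomp (G i) F = zvar i).

Definition deformed_inversion_pair P (Q : {fps K[n.+1]}) :=
  fps_zorder_ge 2 Q /\
  zinverse (fun i => zvar i - tvar * zgrad (fps_widen P) i)
           (fun i => zvar i + tvar * zgrad Q i).

End Deformation.

Arguments zvar {n K}.
Arguments tvar {n K}.

(* Main.v *)
(* Write N for the gradient of Q in z, H for its Hessian, G = z + tN and A for
   (Hess P)(G).  Inversion says N = (grad P)(G); differentiating in z gives
   H = A + tHA, so 1 + tH is inverse to 1 - tA and H = A(1 + tH) = (1 + tH)A.
   Hence H is nilpotent along with Hess P, and Delta Q = tr H = 0 because
   K[[z, t]] is an integral domain.  Differentiating N = (grad P)(G) in t gives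
   the Burgers equation dN/dt = HN, which integrates in z to
   2 dQ/dt = <grad Q, grad Q>.  The two identities combine into
   Delta Q^(k+1) = 2(k+1) d(Q^k)/dt, and as Q = P at t = 0 the coefficients of
   Q^k in t follow by induction. *)

Require Import Defs.
From HB Require Import structures.
From mathcomp Require Import all_boot all_order all_algebra.
From mathcomp Require Import complex boolp reals mpoly ring.

Set Implicit Arguments.
Unset Strict Implicit.
Unset Printing Implicit Defensive.

Import GRing.Theory Num.Theory.
Local Open Scope ring_scope.

(** * Coefficients, order and derivatives of formal power series *)

Section Coefficients.
Variables (n : nat) (K : comNzRingType).
Implicit Types (f g : {fps K[n]}) (m : 'X_{1..n}) (p q : {mpoly K[n]}).

Lemma fps_coef_sum (I : Type) (r : seq I) (P : pred I) (F : I -> {fps K[n]}) m :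
  (\sum_(i <- r | P i) F i) m = \sum_(i <- r | P i) F i m.
Proof. exact: (big_morph (fun f => f m)). Qed.

Lemma fps_coefMn f k m : (f *+ k) m = f m *+ k.
Proof. by elim: k => //= k IH; rewrite !mulrS -IH. Qed.

Lemma fps_coef_order d f m : fps_order_ge d f -> (mdeg m < d)%N -> f m = 0.
Proof.
by move=> fd md; apply/eqP; apply: contraLR md => /fd; rewrite -leqNgt.
Qed.

Lemma fps_orderM d e f g :
  fps_order_ge d f -> fps_order_ge e g -> fps_order_ge (d + e) (f * g).
Proof.
move=> fd ge m; apply: contraNT; rewrite -ltnNge => mde.
apply/eqP/big1 => -[a b] /= /eqP mab.
have [ad|da] := ltnP (mdeg a) d; first by rewrite (fps_coef_order fd) ?mul0r.
rewrite [g b](fps_coef_order ge) ?mulr0 //.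
by rewrite -(ltn_add2l (mdeg a)) -mdegD -mab (leq_trans mde) // leq_add2r.
Qed.

Lemma fps_orderX d f k : fps_order_ge d f -> fps_order_ge (k * d) (f ^+ k).
Proof.
move=> fd; elim: k => [|k IH]; first by rewrite expr0.
by rewrite exprS mulSn; apply: fps_orderM.
Qed.

(* p is a polynomial approximation of f modulo the terms of degree >= d;
   identities for [fps_comp] and [fps_deriv] are transferred from {mpoly K[n]}
   through such approximations. *)
Definition agree_below d f p := forall m, (mdeg m < d)%N -> p@_m = f m.

Lemma agree_trunc d f : agree_below d f (fps_trunc d f).
Proof. exact: fps_truncE. Qed.

Lemma agreeM d f g p q :
  agree_below d f p -> agree_below d g q -> agree_below d (f * g) (p * q).
Proof. by move=> pf qg m md; apply/esym/(fps_mul_trunc md). Qed.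

Lemma agree_deriv d f p i :
  agree_below d.+1 f p -> agree_below d (fps_deriv i f) (mderiv i p).
Proof.
by move=> pf m md; rewrite mcoeff_deriv pf //= mdegD mdeg1 addn1.
Qed.

Lemma fps_derivM i f g :
  fps_deriv i (f * g) = fps_deriv i f * g + f * fps_deriv i g.
Proof.
apply: fpsP => m; pose d := (mdeg m).+1.
(* Differentiation costs one degree of precision, hence truncations at [d.+1]. *)
have [pf qg] := (agree_trunc (d := d.+1) f, agree_trunc (d := d.+1) g).
have sub h r : agree_below d.+1 h r -> agree_below d h r.
  by move=> hr a ad; apply: hr; apply: ltnW.
rewrite -(agree_deriv i (agreeM pf qg) (leqnn _)).
rewrite mderivM mcoeffD; congr (_ + _).
  exact: (agreeM (agree_deriv i pf) (sub _ _ qg)).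
exact: (agreeM (sub _ _ pf) (agree_deriv i qg)).
Qed.

Lemma fps_deriv_is_linear i : linear (@fps_deriv n K i).
Proof. by move=> c f g; apply: fpsP => m /=; rewrite mulrnDl -mulrnAr. Qed.

HB.instance Definition _ i := GRing.isLinear.Build K {fps K[n]} {fps K[n]} _
  (@fps_deriv n K i) (@fps_deriv_is_linear i).

(** Leibniz applied to [1 * 1] doubles the derivative, which therefore cancels. *)
Lemma fps_deriv1 i : fps_deriv i (1 : {fps K[n]}) = 0.
Proof.
apply: (addrI (fps_deriv i 1)).
by rewrite addr0 -{3}[1]mulr1 fps_derivM mulr1 mul1r.
Qed.

Lemma fps_derivX i f k : fps_deriv i (f ^+ k) = f ^+ k.-1 * fps_deriv i f *+ k.
Proof.
elim: k => [|[|k] IH]; first by rewrite expr0 mulr0n fps_deriv1.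
  by rewrite expr1 expr0 mul1r.
rewrite exprS fps_derivM IH /= mulrnAr mulrA -exprS.
by rewrite [fps_deriv i f * _]mulrC -mulrS.
Qed.

Lemma fps_derivC i j f :
  fps_deriv i (fps_deriv j f) = fps_deriv j (fps_deriv i f).
Proof.
apply: fpsP => m /=; rewrite -!mulrnA -!addmA.
rewrite [(U_(j) + _)%MM]addmC !mnmDE !mnm1E.
by have [->//|_] := eqVneq i j; rewrite !addn0 mulnC.
Qed.

Lemma fps_deriv_var i j : fps_deriv i (fps_var K j) = (i == j)%:R :> {fps K[n]}.
Proof.
apply: fpsP => m /=; have [->|ij] := eqVneq i j.
  rewrite -[X in _ == X]add0m eqm_add2r /=.
  by case: eqP => [->|]; rewrite ?mnm0E ?mul0rn.
case: eqP => [e|_]; last by rewrite mul0rn.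
have := congr1 (fun a : 'X_{1..n} => a i) e; rewrite mnmDE !mnm1E eqxx.
by rewrite eq_sym (negPf ij) addn1.
Qed.

Lemma fps_varM i f m : (fps_var K i * f) (m + U_(i))%MM = f m.
Proof.
(* The exponent [m + U_(i)] has degree [(mdeg m).+1], which [d] must exceed. *)
pose d := (mdeg m).+2.
rewrite -[LHS](@agreeM d _ _ 'X_i (fps_trunc d f)).
- by rewrite mulrC addmC mcoeffMX agree_trunc // ltnS.
- by move=> a _; rewrite mcoeffX eq_sym.
- exact: agree_trunc.
- by rewrite mdegD mdeg1 addn1.
Qed.

Lemma fps_varM0 i f m : m i = 0%N -> (fps_var K i * f) m = 0.
Proof.
move=> mi; apply: big1 => -[a b] /= /eqP mab.
have [e|] := eqVneq _ U_(i)%MM; last by rewrite mul0r.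
have := congr1 (fun c : 'X_{1..n} => c i) mab.
by rewrite e mnmDE mnm1E eqxx mi.
Qed.

End Coefficients.

(** * Substitution of series without constant term, and the chain rule *)

Section Composition.
Variables (n p : nat) (K : comNzRingType) (F : 'I_n -> {fps K[p]}).
Hypothesis F0 : forall i, fps_order_ge 1 (F i).
Implicit Types (f g : {fps K[n]}) (u v : {mpoly K[n]}) (m : 'X_{1..p}).

(** On polynomials substitution is one finite sum, whatever coefficient is inspected, hence a ring
    morphism; multiplicativity and the chain rule for [fps_comp] are derived from it. *)
Definition mpoly_comp u : {fps K[p]} := mmap (in_alg {fps K[p]}) F u.

Lemma fps_order_mmap1 (a : 'X_{1..n}) : fps_order_ge (mdeg a) (mmap1 F a).
Proof.
rewrite /mmap1 mdegE; elim/big_ind2: _ => // [d f e g fd ge|i _].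
  exact: fps_orderM.
by have := fps_orderX (k := a i) (@F0 i); rewrite muln1.
Qed.

Lemma fps_order_mpoly_comp d u :
  (forall a, (mdeg a < d)%N -> u@_a = 0) -> fps_order_ge d (mpoly_comp u).
Proof.
move=> ud m; apply: contraNT; rewrite -ltnNge => md.
apply/eqP; rewrite fps_coef_sum big1_seq // => a _.
rewrite in_algE mulr_algl /=; have [ad|da] := ltnP (mdeg a) d.
  by rewrite ud // mul0r.
by rewrite (fps_coef_order (@fps_order_mmap1 a)) ?mulr0 // (leq_trans md).
Qed.

(** As no [F i] has a constant term, monomials of degree above [mdeg m] cannot reach the coefficient
    at [m], so any close enough polynomial may replace the truncation used in [fps_comp]. *)
Lemma fps_compE d f u m :
  agree_below d f u -> (mdeg m < d)%N -> fps_comp f F m = mpoly_comp u m.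
Proof.
move=> fu md; pose v := fps_trunc (mdeg m).+1 f.
transitivity (mpoly_comp v m).
  rewrite /= /mpoly_comp /v /fps_trunc raddf_sum /=; congr (fpscoef _ m).
  by apply: eq_bigr => a _; rewrite mmapZ mmapX /= mulr_algl.
apply/eqP; rewrite -subr_eq0; apply/eqP.
have -> : mpoly_comp v m - mpoly_comp u m = mpoly_comp (v - u) m.
  by rewrite /mpoly_comp raddfB.
apply: (@fps_coef_order _ _ (mdeg m).+1) => //.
apply: fps_order_mpoly_comp => a ad; rewrite mcoeffB fu; last first.
  by apply: leq_trans md.
by rewrite /v fps_truncE // subrr.
Qed.

Lemma fps_comp1 : fps_comp 1 F = 1.
Proof.
apply: fpsP => m; rewrite (@fps_compE (mdeg m).+1 _ 1) //.
  by rewrite /mpoly_comp rmorph1.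
by move=> a _; rewrite mcoeff1.
Qed.

Lemma fps_compM f g : fps_comp (f * g) F = fps_comp f F * fps_comp g F.
Proof.
apply: fpsP => m; pose d := (mdeg m).+1.
have [fu gv] := (agree_trunc (d := d) f, agree_trunc (d := d) g).
rewrite (fps_compE (agreeM fu gv)) // /mpoly_comp rmorphM /=.
apply: eq_bigr => -[[a ad] [b bd]] _ /=.
by rewrite -(fps_compE fu) // -(fps_compE gv).
Qed.

Lemma fps_comp_var i : fps_comp (fps_var K i) F = F i.
Proof.
apply: fpsP => m; rewrite (@fps_compE (mdeg m).+1 _ 'X_i) //.
  by rewrite /mpoly_comp mmapX mmap1U.
by move=> a _; rewrite mcoeffX eq_sym.
Qed.

Lemma mpoly_comp_deriv k u :
  fps_deriv k (mpoly_comp u) =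
    \sum_j mpoly_comp (mderiv j u) * fps_deriv k (F j).
Proof.
(* [T] holds for 1 and the variables, passes to products and so to monomials, and by linearity to
   all polynomials. *)
pose T u := fps_deriv k (mpoly_comp u) =
  \sum_j mpoly_comp (mderiv j u) * fps_deriv k (F j).
have T1 : T 1.
  rewrite /T /mpoly_comp rmorph1 fps_deriv1 big1 // => j _.
  by rewrite -mpolyC1 mderivC raddf0 mul0r.
have TX j : T 'X_j.
  rewrite /T /mpoly_comp mmapX mmap1U (bigD1 j) //= big1 ?addr0.
    rewrite mderivX mnm1E eqxx scale1r.
    rewrite (_ : U_(j) - U_(j) = 0)%MM ?mpolyX0 ?rmorph1 ?mul1r //.
    by apply/mnmP => i; rewrite mnmBE mnm0E subnn.
  move=> i ij; rewrite mderivX mnm1E eq_sym (negPf ij) scale0r.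
  by rewrite raddf0 mul0r.
have TM u1 u2 : T u1 -> T u2 -> T (u1 * u2).
  rewrite /T /mpoly_comp rmorphM fps_derivM => -> ->.
  rewrite mulr_suml mulr_sumr -big_split; apply: eq_bigr => j _ /=.
  rewrite mderivM raddfD /= !rmorphM /= mulrDl mulrAC; congr (_ + _).
  by rewrite mulrA.
rewrite [u]mpolyE -/(T _); elim/big_ind: _ => [|u1 u2|a _].
- rewrite /T /mpoly_comp raddf0 linear0 big1 // => j _.
  by rewrite linear0 raddf0 mul0r.
- rewrite /T /mpoly_comp raddfD linearD /= => -> ->.
  rewrite -big_split; apply: eq_bigr => j _ /=.
  by rewrite linearD raddfD mulrDl.
have Ta : T 'X_[a].
  rewrite mpolyXE_id; elim/big_ind: _ => // i _.
  by elim: (a i) => [|e IH]; rewrite ?expr0 // exprS; apply: TM.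
move: Ta; rewrite /T /mpoly_comp mmapZ /= mulr_algl linearZ /= => ->.
rewrite scaler_sumr; apply: eq_bigr => j _.
by rewrite linearZ /= mmapZ /= -scalerAl mul1r scalerAl.
Qed.

Lemma fps_comp_deriv k f :
  fps_deriv k (fps_comp f F) =
    \sum_j fps_comp (fps_deriv j f) F * fps_deriv k (F j).
Proof.
(* The left side reads a coefficient of degree [(mdeg m).+1], and on the right the derivatives of
   [f] lose one degree of precision. *)
apply: fpsP => m; pose d := (mdeg m).+2.
have fu := agree_trunc (d := d) f.
transitivity (fps_deriv k (mpoly_comp (fps_trunc d f)) m).
  by rewrite -[LHS]/(fps_comp f F _ *+ _) (fps_compE fu) // mdegD mdeg1 addn1.
rewrite mpoly_comp_deriv !fps_coef_sum; apply: eq_bigr => j _.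
apply: eq_bigr => -[[a ad] [b bd]] _ /=.
by rewrite -(fps_compE (agree_deriv j fu)).
Qed.

End Composition.

(** * Additivity of substitution, and substitution of the variables themselves *)

Section CompositionLinear.
Variables (n p : nat) (K : comNzRingType) (F : 'I_n -> {fps K[p]}).
Implicit Types f g : {fps K[n]}.

Lemma fps_comp0 : fps_comp (0 : {fps K[n]}) F = 0.
Proof.
apply: fpsP => m /=; rewrite fps_coef_sum big1 // => a _.
by rewrite /= mul0r.
Qed.

Lemma fps_compB f g : fps_comp (f - g) F = fps_comp f F - fps_comp g F.
Proof.
apply: fpsP => m /=; rewrite !fps_coef_sum -sumrB; apply: eq_bigr => a _ /=.
by rewrite mulrBl.
Qed.

Lemma fps_compD f g : fps_comp (f + g) F = fps_comp f F + fps_comp g F.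
Proof.
apply: fpsP => m /=; rewrite !fps_coef_sum -big_split.
by apply: eq_bigr => a _ /=; rewrite mulrDl.
Qed.

End CompositionLinear.

Lemma fps_var_order n (K : comNzRingType) (i : 'I_n) :
  fps_order_ge 1 (fps_var K i).
Proof.
by move=> m /=; case: (m =P U_(i)%MM) => [->|]; rewrite ?mdeg1 ?eqxx.
Qed.

Lemma fps_comp_id n (K : comNzRingType) (f : {fps K[n]}) :
  fps_comp f (@fps_var n K) = f.
Proof.
apply: fpsP => m; pose d := (mdeg m).+1.
have fu := agree_trunc (d := d) f.
rewrite (fps_compE (@fps_var_order n K) fu) // -(fu m) //.
move: (fps_trunc d f) => u {fu}.
suff -> : mpoly_comp (@fps_var n K) u = Fps (fun a => u@_a) by [].
rewrite [in LHS](mpolyE u) /mpoly_comp raddf_sum; apply: fpsP => a.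
rewrite fps_coef_sum -[RHS]/(u@_a) [in RHS](mpolyE u) raddf_sum.
apply: eq_bigr => b _.
rewrite -[LHS]/(mpoly_comp (@fps_var n K) (u@_b *: 'X_[b]) a) /mpoly_comp.
rewrite mmapZ mmapX -[LHS]/(fpscoef (_%:A * mmap1 (@fps_var n K) b) a) mulr_algl.
rewrite -[RHS]/((u@_b *: 'X_[b])@_a) mcoeffZ /=.
congr (_ * _); rewrite mpolyXE_id.
(* [h] embeds polynomials into series; being multiplicative, it reduces the claim on monomials to
   single variables. *)
pose h (v : {mpoly K[n]}) : {fps K[n]} := Fps (fun a => v@_a).
have h1 : h 1 = 1 by apply: fpsP => c /=; rewrite mcoeff1.
have hM : {morph h : v w / v * w}.
  by move=> v w; apply: fpsP => c /=; rewrite mcoeffM.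
rewrite -[RHS]/(h _ a) (big_morph h hM h1); congr (fpscoef _ a).
apply: eq_bigr => i _; elim: (b i) => [|e IH]; first by rewrite !expr0.
rewrite !exprS hM IH; congr (_ * _).
by apply: fpsP => c /=; rewrite mcoeffX eq_sym.
Qed.

(** * Series in z and t through their coefficients in t *)

Section Slices.
Variables (n : nat) (K : comNzRingType).
Implicit Types (f g : {fps K[n.+1]}) (P : {fps K[n]}).
Implicit Types (a b : 'X_{1..n}) (m : 'X_{1..n.+1}).

(* The exponent of z^a t^j. *)
Definition mnm_ext a (j : nat) : 'X_{1..n.+1} :=
  [multinom (if unlift ord_max i is Some k then a k else j) | i < n.+1].

Definition mnm_res m : 'X_{1..n} := [multinom m (zidx i) | i < n].

Lemma unlift_zidx (i : 'I_n) : unlift ord_max (zidx i) = Some i.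
Proof.
rewrite (_ : zidx i = lift ord_max i) ?liftK //.
exact/val_inj/esym/lift_max.
Qed.

Lemma mnm_ext_z a j i : mnm_ext a j (zidx i) = a i.
Proof. by rewrite mnmE unlift_zidx. Qed.

Lemma mnm_ext_t a j : mnm_ext a j ord_max = j.
Proof. by rewrite mnmE unlift_none. Qed.

Lemma mnm_extP m1 m2 :
  (forall i, m1 (zidx i) = m2 (zidx i)) -> m1 ord_max = m2 ord_max -> m1 = m2.
Proof.
move=> ez et; apply/mnmP => i; case: (unliftP ord_max i) => [j ->|-> //].
by rewrite (_ : lift _ _ = zidx j) //; exact/val_inj/lift_max.
Qed.

Lemma mnm_resK m : mnm_ext (mnm_res m) (m ord_max) = m.
Proof.
by apply: mnm_extP => [i|]; rewrite ?mnm_ext_t // mnm_ext_z mnmE.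
Qed.

Lemma mnm_extK a j : mnm_res (mnm_ext a j) = a.
Proof. by apply/mnmP => i; rewrite mnmE mnm_ext_z. Qed.

Lemma mdeg_ext a j : mdeg (mnm_ext a j) = (mdeg a + j)%N.
Proof.
rewrite !mdegE big_ord_recr /= mnm_ext_t; congr (_ + _)%N.
by apply: eq_bigr => i _; rewrite mnm_ext_z.
Qed.

Lemma mnm_ext_D a b j k :
  mnm_ext (a + b) (j + k) = (mnm_ext a j + mnm_ext b k)%MM.
Proof.
by apply: mnm_extP => [i|]; rewrite mnmDE ?mnm_ext_t // !mnm_ext_z mnmDE.
Qed.

Lemma mnm_ext_Uz i : mnm_ext U_(i) 0 = U_(zidx i)%MM.
Proof.
apply: mnm_extP => [j|]; rewrite ?mnm_ext_z ?mnm_ext_t !mnm1E.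
  by rewrite -!val_eqE.
by rewrite -val_eqE /= ltn_eqF.
Qed.

Lemma mnm_ext_Ut : mnm_ext 0 1 = U_(ord_max)%MM.
Proof.
apply: mnm_extP => [j|]; rewrite ?mnm_ext_z ?mnm_ext_t !mnm1E ?mnm0E ?eqxx //.
by rewrite -val_eqE /= gtn_eqF.
Qed.

(* The coefficient of t^j, as a series in z. *)
Definition slice (j : nat) f : {fps K[n]} := Fps (fun a => f (mnm_ext a j)).

Lemma slice_inj f g : (forall j, slice j f = slice j g) -> f = g.
Proof.
move=> fg; apply: fpsP => m; rewrite -(mnm_resK m).
by have /(congr1 (fun h => fpscoef h (mnm_res m))) := fg (m ord_max).
Qed.

Fact slice_is_linear j : linear (slice j).
Proof. by []. Qed.

HB.instance Definition _ j :=
  GRing.isLinear.Build K {fps K[n.+1]} {fps K[n]} _ (slice j)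
    (slice_is_linear j).

Lemma big_ext0 d (E : 'X_{1..n.+1} -> K) :
  \sum_(m : 'X_{1..n.+1 < d} | m ord_max == 0%N) E m =
    \sum_(a : 'X_{1..n < d}) E (mnm_ext a 0).
Proof.
have extd (a : 'X_{1..n < d}) : (mdeg (mnm_ext a 0) < d)%N.
  by rewrite mdeg_ext addn0 bmdeg.
have resd (m : 'X_{1..n.+1 < d}) : (mdeg (mnm_res m) < d)%N.
  apply: leq_ltn_trans (bmdeg m).
  by rewrite -{2}[bmnm m]mnm_resK mdeg_ext leq_addr.
rewrite (reindex_onto (fun k : 'X_{1..n < d} => BMultinom (extd k))
          (fun k : 'X_{1..n.+1 < d} => BMultinom (resd k))) /=; last first.
  by move=> m /eqP m0; apply: val_inj; rewrite /= -{2}[bmnm m]mnm_resK m0.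
apply: eq_bigl => a; rewrite mnm_ext_t eqxx /=.
by apply/eqP/val_inj; rewrite /= mnm_extK.
Qed.

(** An exponent free of t splits only into exponents free of t, so setting t = 0 is
    multiplicative. *)
Lemma slice0M f g : slice 0 (f * g) = slice 0 f * slice 0 g.
Proof.
apply: fpsP => a /=; rewrite mdeg_ext addn0.
set d := (mdeg a).+1.
rewrite [LHS]big_mkcond -(pair_bigA _ (fun k1 k2 : 'X_{1..n.+1 < d} =>
  if mnm_ext a 0 == (k1 + k2)%MM then f k1 * g k2 else 0)) /=.
rewrite [RHS]big_mkcond -(pair_bigA _ (fun k1 k2 : 'X_{1..n < d} =>
  if a == (k1 + k2)%MM then f (mnm_ext k1 0) * g (mnm_ext k2 0) else 0)) /=.
have t0 (m1 m2 : 'X_{1..n.+1}) : (mnm_ext a 0 == m1 + m2)%MM ->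
    (m1 ord_max == 0%N) && (m2 ord_max == 0%N).
  by move=> /eqP e; rewrite -addn_eq0 -mnmDE -e mnm_ext_t.
rewrite (bigID (fun m : 'X_{1..n.+1 < d} => m ord_max == 0%N)) /=.
rewrite [X in _ + X]big1 ?addr0; last first.
  move=> m1 m1t; apply: big1 => m2 _; case: ifP => // /t0.
  by rewrite (negPf m1t).
rewrite (big_ext0 _ (fun k1 => \sum_(k2 : 'X_{1..n.+1 < d})
  (if mnm_ext a 0 == (k1 + k2)%MM then f k1 * g k2 else 0))).
apply: eq_bigr => k1 _.
rewrite (bigID (fun m : 'X_{1..n.+1 < d} => m ord_max == 0%N)) /=.
rewrite [X in _ + X]big1 ?addr0; last first.
  move=> m2 m2t; case: ifP => // /t0.
  by rewrite (negPf m2t) andbF.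
rewrite (big_ext0 _ (fun k2 => if mnm_ext a 0 == (mnm_ext k1 0 + k2)%MM
  then f (mnm_ext k1 0) * g k2 else 0)).
apply: eq_bigr => k2 _; rewrite -mnm_ext_D addn0.
by rewrite (can_eq (fun a => mnm_extK a 0)).
Qed.

Lemma slice0_1 : slice 0 1 = 1.
Proof.
apply: fpsP => a /=; rewrite -(can_eq (fun a => mnm_extK a 0)).
congr (_ == _)%:R.
by apply: mnm_extP => [i|]; rewrite ?mnm_ext_z ?mnm_ext_t !mnm0E.
Qed.

Lemma slice0X f k : slice 0 (f ^+ k) = slice 0 f ^+ k.
Proof.
by elim: k => [|k IH]; rewrite ?expr0 ?slice0_1 // !exprS slice0M IH.
Qed.

Lemma slice_zderiv j i f :
  slice j (fps_deriv (zidx i) f) = fps_deriv i (slice j f).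
Proof.
by apply: fpsP => a /=; rewrite mnm_ext_z -mnm_ext_Uz -mnm_ext_D addn0.
Qed.

Lemma slice_tderiv j f :
  slice j (fps_deriv ord_max f) = slice j.+1 f *+ j.+1.
Proof.
apply: fpsP => a; rewrite fps_coefMn /= mnm_ext_t -mnm_ext_Ut -mnm_ext_D.
by rewrite addm0 addn1.
Qed.

Lemma slice0_tvar f : slice 0 (tvar * f) = 0.
Proof. by apply: fpsP => a; apply: fps_varM0; rewrite mnm_ext_t. Qed.

Lemma sliceS_tvar j f : slice j.+1 (tvar * f) = slice j f.
Proof.
apply: fpsP => a; rewrite [LHS]/(fpscoef _ _) -addn1 -[a in LHS]addm0.
by rewrite mnm_ext_D mnm_ext_Ut [LHS]fps_varM.
Qed.

Lemma tvar_inj : injective (fun f : {fps K[n.+1]} => tvar * f).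
Proof.
move=> f g /= fg; apply: slice_inj => j.
by rewrite -sliceS_tvar fg sliceS_tvar.
Qed.

Lemma slice_widen j P : slice j (fps_widen P) = if j == 0%N then P else 0.
Proof.
apply: fpsP => a /=; rewrite mnm_ext_t; case: eqP => // _.
by rewrite -/(mnm_res _) mnm_extK.
Qed.

Lemma slice_tvarX_widen j k P :
  slice j (tvar ^+ k * fps_widen P) = if j == k then P else 0.
Proof.
elim: k j => [|k IH] [|j]; rewrite ?expr0 ?mul1r ?slice_widen //.
  by rewrite exprS -mulrA slice0_tvar.
by rewrite exprS -mulrA sliceS_tvar IH.
Qed.

Lemma widen_zderiv i P :
  fps_deriv (zidx i) (fps_widen P) = fps_widen (fps_deriv i P).
Proof.
apply: slice_inj => j; rewrite slice_zderiv !slice_widen.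
by case: eqP => // _; rewrite linear0.
Qed.

(** Slice [j] of the partial sums is stationary once the term [j] is included, so convergence is
    read off slice by slice. *)
Lemma fps_has_sum_slice (c : nat -> {fps K[n]}) S :
  fps_has_sum (fun j => tvar ^+ j * fps_widen (c j)) S <->
  forall j, slice j S = c j.
Proof.
have coef N j : slice j (\sum_(i < N) tvar ^+ i * fps_widen (c i)) =
    if (j < N)%N then c j else 0.
  rewrite linear_sum /=; under eq_bigr do rewrite slice_tvarX_widen.
  case: ltnP => jN.
    rewrite (bigD1 (Ordinal jN)) //= eqxx big1 ?addr0 // => i.
    by rewrite -val_eqE eq_sym /= => /negPf ->.
  by apply: big1 => i _; rewrite gtn_eqF // (leq_trans (ltn_ord i)).
split=> [cS j | cS m].
  apply: fpsP => a; have [N NS] := cS (mnm_ext a j).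
  (* At [maxn N j.+1] the coefficient is stable and the term [j] is already in the partial sum. *)
  rewrite -[LHS]/(S _) -(NS (maxn N j.+1)) ?leq_maxl //.
  rewrite -[LHS]/(slice j _ a).
  by rewrite coef leq_maxr.
exists (m ord_max).+1 => N mN; rewrite -(mnm_resK m).
by rewrite -[RHS]/(slice _ _ _) cS -[LHS]/(slice _ _ _) coef mN.
Qed.

Lemma fps_comp_slice0 p (F : 'I_p -> {fps K[n.+1]}) (P : {fps K[p]}) :
  slice 0 (fps_comp P F) = fps_comp P (fun i => slice 0 (F i)).
Proof.
apply: fpsP => a /=; rewrite !fps_coef_sum mdeg_ext addn0.
apply: eq_bigr => b _ /=; congr (_ * _); rewrite -[LHS]/(slice 0 _ a).
rewrite (big_morph (slice 0) slice0M slice0_1); congr (fpscoef _ a).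
by apply: eq_bigr => i _; rewrite slice0X.
Qed.

(** Monomials containing t have coefficient zero in [fps_widen P], so the value [tvar] of the last
    variable never enters. *)
Lemma zcomp_widen P (G : 'I_n -> {fps K[n.+1]}) :
  zcomp (fps_widen P) G = fps_comp P G.
Proof.
apply: fpsP => m /=; rewrite !fps_coef_sum.
rewrite (bigID (fun a : 'X_{1..n.+1 < (mdeg m).+1} => a ord_max == 0%N)) /=.
rewrite [X in _ + X]big1 ?addr0; last by move=> a /negPf ->; rewrite mul0r.
pose F (j : 'I_n.+1) := if unlift ord_max j is Some i then G i else tvar.
rewrite (big_ext0 _ (fun m1 =>
  (if m1 ord_max == 0%N then P (mnm_res m1) else 0) *
  (\prod_j F j ^+ m1 j) m)).
apply: eq_bigr => a _; rewrite mnm_ext_t eqxx mnm_extK.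
suff -> : \prod_j F j ^+ mnm_ext a 0 j = \prod_i G i ^+ a i by [].
rewrite big_ord_recr /= mnm_ext_t expr0 mulr1.
by apply: eq_bigr => i _; rewrite mnm_ext_z /F unlift_zidx.
Qed.

End Slices.

(** * Power series over a domain form a domain; traces of nilpotent matrices *)

Section IntegralDomain.
Variables (n : nat) (K : idomainType).
Implicit Types f g : {fps K[n]}.

(** The monomial order refines the degree, so the least monomial of a truncation that keeps some
    nonzero coefficient is least for the whole series. *)
Lemma fps_least_monomial f :
  f != 0 -> exists2 l, f l != 0 & forall m, (m < l)%O -> f m = 0.
Proof.
move=> f0; have [a fa] : exists m, f m != 0.
  apply: contrapT => fm; case/eqP: f0; apply: fpsP => m.
  by apply: contrapT => /eqP fm0; apply: fm; exists m.
pose d := (mdeg a).+1; pose u := fps_trunc d f.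
have au : a \in msupp u by rewrite mcoeff_msupp fps_truncE.
have ld : (mdeg (mlast u) < d)%N by rewrite ltnS lemc_mdeg // mlast_lemc.
have u0 : u != 0 by apply: contraTneq au => ->; rewrite msupp0.
exists (mlast u) => [|m lm].
  by have := mlast_supp u0; rewrite mcoeff_msupp fps_truncE.
rewrite -(mcoeff_lt_mlast lm) fps_truncE //.
by apply: leq_ltn_trans ld; apply: lemc_mdeg; apply: Order.POrderTheory.ltW.
Qed.

(** At the sum of the two least exponents the product has as coefficient the product of the least
    coefficients: any other splitting has one part below its least exponent. *)
Fact fps_integral : GRing.integral_domain_axiom {fps K[n]}.
Proof.
move=> f g fg0; apply/norP => -[/fps_least_monomial[a fa fl]].
move=> /fps_least_monomial[b gb gl].
have /eqP := congr1 (fun h => fpscoef h (a + b)%MM) fg0; apply/negP.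
have ab : (mdeg a < (mdeg (a + b)).+1)%N by rewrite ltnS mdegD leq_addr.
have ba : (mdeg b < (mdeg (a + b)).+1)%N by rewrite ltnS mdegD leq_addl.
rewrite /= (bigD1 (BMultinom ab, BMultinom ba)) //= big1 ?addr0 ?mulf_neq0 //.
move=> -[[k1 /= lt1] [k2 /= lt2]] /andP[/= /eqP e].
rewrite -pair_eqE /= -!val_eqE /= => ne.
case: (Order.TotalTheory.ltgtP k1 a) => [/fl ->|ak|ka]; first by rewrite mul0r.
  case: (Order.TotalTheory.leP b k2) => [bk|/gl ->]; last by rewrite mulr0.
  by have := ltmc_le_add ak bk; rewrite e Order.POrderTheory.ltxx.
move: e ne; rewrite ka => /addmI ->; by rewrite !eqxx.
Qed.

(** The domain structure carries units and inverses; they are chosen classically, the inverse being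
    the identity off the units. *)
Definition fps_unit : {pred {fps K[n]}} :=
  [pred f | `[< exists g, g * f = 1 >]].

Definition fps_inv f : {fps K[n]} :=
  if pselect (exists g, g * f = 1) is left fU then sval (cid fU) else f.

Fact fps_mulVf : {in fps_unit, left_inverse 1 fps_inv *%R}.
Proof.
move=> f /asboolP fU; rewrite /fps_inv; case: pselect => // fU'.
exact: svalP (cid fU').
Qed.

Fact fps_unitPl f g : g * f = 1 -> fps_unit f.
Proof. by move=> gf; apply/asboolP; exists g. Qed.

Fact fps_inv_out : {in [predC fps_unit], fps_inv =1 id}.
Proof.
move=> f fU; rewrite /fps_inv; case: pselect => // fU'.
by case/negP: fU; apply/asboolP.
Qed.

HB.instance Definition _ := GRing.ComNzRing_hasMulInverse.Build {fps K[n]}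
  fps_mulVf fps_unitPl fps_inv_out.
HB.instance Definition _ := GRing.ComUnitRing_isIntegral.Build {fps K[n]}
  fps_integral.

End IntegralDomain.

(** Over a domain the characteristic polynomial is associated to a power of X, of degree the size of
    [A]; its next-to-leading coefficient, minus the trace, is then zero. *)
Lemma mxtrace_nilpotent (R : idomainType) n (A : 'M[R]_n) N :
  A ^+ N = 0 -> \tr A = 0.
Proof.
case: n A => [|n] A AN; first by rewrite /mxtrace big_ord0.
pose B := map_mx polyC A.
have BN : B ^+ N = 0 by rewrite /B -rmorphXn /= AN map_mx0.
(* X^N - B^N = (X - B)(...), so the characteristic polynomial divides a power
   of X. *)
have comm : GRing.comm ('X%:M : 'M[{poly R}]_n.+1) B.
  by rewrite /GRing.comm -!mulmxE scalar_mxC.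
have /(congr1 determinant) := subrXX_comm N comm.
rewrite BN subr0 -mulmxE det_mulmx -rmorphXn det_scalar -exprM.
rewrite -[\det _]/(char_poly A) => XN.
have : char_poly A %| ('X - 0%:P) ^+ (N * n.+1) by rewrite subr0 XN dvdp_mulr.
case/dvdp_exp_XsubCP => k _; rewrite subr0 => cXk.
have kn : k = n.+1.
  by have := eqp_size cXk; rewrite size_char_poly size_polyXn => -[].
have /eqpP[[c d] /= /andP[c0 d0]] := cXk.
move/(congr1 (fun p : {poly R} => p`_n)); rewrite !coefZ coefXn kn ltn_eqF //.
have := char_poly_trace A isT => /= ->.
by rewrite mulr0 => /eqP; rewrite mulf_eq0 (negPf c0) oppr_eq0 => /eqP.
Qed.

(** * The inversion pair of a Hessian nilpotent series *)

Section HessianNilpotent.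
Variables (n : nat) (K : numFieldType).
Implicit Types (f g : {fps K[n]}).

(** In characteristic zero, a coefficient at [m] with [m i] nonzero survives in the [i]-th
    derivative, multiplied by [m i]. *)
Lemma fps_deriv_eq0 f : (forall i, fps_deriv i f = 0) -> f 0%MM = 0 -> f = 0.
Proof.
move=> df f0; apply: fpsP => m; have [->//|m0] := eqVneq m 0%MM.
have [i mi] : exists i, m i != 0%N.
  apply/existsP; apply: contraNT m0 => /existsPn m0; apply/eqP/mnmP => i.
  by rewrite mnm0E; apply/eqP; have := m0 i; rewrite negbK.
have := congr1 (fun h => fpscoef h (m - U_(i))%MM) (df i).
rewrite /= submK ?lep1mP // => /eqP; rewrite mulrn_eq0 /= => /eqP.
exact.
Qed.

Lemma laplacian_is_linear : linear (@laplacian n K).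
Proof.
move=> c f g; rewrite /laplacian scaler_sumr -big_split.
by apply: eq_bigr => i _; rewrite !linearP.
Qed.

HB.instance Definition _ :=
  GRing.isLinear.Build K {fps K[n]} {fps K[n]} _ (@laplacian n K)
    laplacian_is_linear.

Variables (P : {fps K[n]}) (Q : {fps K[n.+1]}).
Hypothesis oP : fps_order_ge 2 P.
Hypothesis hnP : hessian_nilpotent P.
Hypothesis PQ : deformed_inversion_pair P Q.

Let N (i : 'I_n) := zgrad Q i.
Let G (i : 'I_n) : {fps K[n.+1]} := zvar i + tvar * N i.

Let orderG i : fps_order_ge 1 (G i).
Proof.
move=> m; apply: contraNT; rewrite -leqNgt leqn0 mdeg_eq0 => /eqP ->.
have -> : G i 0%MM = fps_var K (zidx i) 0%MM + (tvar * N i) 0%MM by [].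
rewrite (fps_coef_order (@fps_var_order _ _ _)) ?mdeg0 // add0r.
by rewrite fps_varM0 // mnm0E.
Qed.

(** The first half of [zinverse] reads z_i + t N_i - t (d_i P)(G) = z_i; cancel z_i, then t. *)
Let gradQ i : N i = fps_comp (fps_deriv i P) G.
Proof.
pose F (j : 'I_n.+1) := if unlift ord_max j is Some i then G i else tvar.
have oF j : fps_order_ge 1 (F j).
  by rewrite /F; case: unlift => // *; apply: fps_var_order.
have [_ [/(_ i) + _]] := PQ.
rewrite /zcomp fps_compB fps_compM // !fps_comp_var // /F unlift_none.
rewrite unlift_zidx -/(zcomp _ _) /zgrad widen_zderiv zcomp_widen.
move/eqP; rewrite subr_eq => /eqP /addrI; exact: tvar_inj.
Qed.

Let A : 'M[{fps K[n.+1]}]_n := \matrix_(i, j) fps_comp (hessian P i j) G.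
Let H : 'M[{fps K[n.+1]}]_n := \matrix_(i, j) fps_deriv (zidx i) (N j).

(** The direction [k] may be t as well as a z-variable: z-directions give [H_fixpoint], and t gives
    [gradQ_burgers]. *)
Let chainH k (i : 'I_n) :
  fps_deriv k (N i) =
    \sum_j (fps_deriv k (zvar j) + fps_deriv k (tvar * N j)) * A j i.
Proof.
rewrite {1}gradQ fps_comp_deriv //; apply: eq_bigr => j _.
by rewrite mxE mxE linearD mulrC.
Qed.

Let H_fixpoint : H = A + tvar *: (H *m A).
Proof.
apply/matrixP => i k; rewrite [LHS]mxE chainH !mxE mulr_sumr.
under eq_bigr do rewrite mulrDl; rewrite big_split /=; congr (_ + _).
  rewrite (bigD1 i) //= big1 ?addr0 => [|j ji].
    by rewrite fps_deriv_var eqxx mul1r !mxE.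
  by rewrite fps_deriv_var -val_eqE /= val_eqE eq_sym (negPf ji) mul0r.
apply: eq_bigr => j _; rewrite [H i j]mxE mulrA fps_derivM fps_deriv_var.
by rewrite -val_eqE /= ltn_eqF // mul0r add0r.
Qed.

Let resolvent : (1%:M - tvar *: A) *m (1%:M + tvar *: H) = 1%:M.
Proof.
(* The fixpoint equation yields the product in the opposite order; a one-sided inverse of a square
   matrix is two-sided. *)
apply: mulmx1C; rewrite mulmxDl mul1mx mulmxBr mulmx1 -scalemxAr -scalemxAl.
by rewrite {1}H_fixpoint scalerDr addrK subrK.
Qed.

Let A_resolvent : A *m (1%:M + tvar *: H) = H.
Proof.
transitivity (H *m ((1%:M - tvar *: A) *m (1%:M + tvar *: H))); last first.
  by rewrite resolvent mulmx1.
by rewrite mulmxA; congr (_ *m _);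
  rewrite mulmxBr mulmx1 -scalemxAr {1}H_fixpoint addrK.
Qed.

Let A_nilpotent : exists e : nat, A ^+ e = 0.
Proof.
have [e He] := hnP; exists e.
(* Entrywise substitution respects matrix products, as [fps_comp] is additive and multiplicative. *)
have -> : A ^+ e = map_mx (fun f => fps_comp f G) (hessian P ^+ e).
  elim: (e) => [|d IH].
    rewrite !expr0; apply/matrixP => i j; rewrite !mxE.
    by case: eqP => _; rewrite ?fps_comp1 ?fps_comp0.
  rewrite !exprS IH; apply/matrixP => i j; rewrite !mxE.
  rewrite (big_morph (fun f => fps_comp f G) (fps_compD G) (fps_comp0 G)).
  by apply: eq_bigr => l _; rewrite fps_compM // !mxE.
by rewrite He; apply/matrixP => i j; rewrite !mxE fps_comp0.
Qed.

Lemma laplacian_inversion_eq0 :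
  \sum_i fps_deriv (zidx i) (fps_deriv (zidx i) Q) = 0.
Proof.
have [e Ae] := A_nilpotent.
transitivity (\tr H); first by apply: eq_bigr => i _; rewrite mxE.
apply: (@mxtrace_nilpotent _ _ _ e).
(* Both products of [A] with [1 + tH] equal [H]; since the factors commute, the e-th power of [H]
   contains that of [A]. *)
have comm : GRing.comm A (1%:M + tvar *: H).
  rewrite /GRing.comm -!mulmxE A_resolvent mulmxDl mul1mx -scalemxAl.
  exact: H_fixpoint.
by rewrite -A_resolvent mulmxE exprMn_comm // Ae mul0r.
Qed.

Let gradQ_burgers k :
  fps_deriv ord_max (N k) = \sum_j N j * fps_deriv (zidx j) (N k).
Proof.
pose u : 'rV_n := \row_j N j; pose v : 'rV_n := \row_j fps_deriv ord_max (N j).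
suff /matrixP/(_ 0 k) : v = u *m H.
  by rewrite !mxE => ->; apply: eq_bigr => j _; rewrite !mxE.
(* Since d(t N_j)/dt = N_j + t dN_j/dt, [chainH] reads v = (u + tv)A; multiplying v(1 - tA) = uA by
   1 + tH gives v = uH. *)
have uA : u *m A = v *m (1%:M - tvar *: A).
  apply/eqP; rewrite mulmxBr mulmx1 -scalemxAr eq_sym subr_eq; apply/eqP.
  apply/matrixP => i j; rewrite !mxE chainH mulr_sumr -big_split.
  apply: eq_bigr => l _; rewrite fps_derivM !fps_deriv_var eqxx mul1r !mxE.
  by rewrite -val_eqE /= gtn_eqF // add0r mulrDl mulrA.
rewrite -A_resolvent mulmxA uA -mulmxA -[LHS]mulmx1; congr (_ *m _).
by rewrite resolvent.
Qed.

Let Q_order j a : (mdeg a < 2)%N -> slice j Q a = 0.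
Proof.
have [oQ _] := PQ; move=> a2; apply/eqP; apply: contraLR a2 => /oQ.
rewrite -leqNgt mdegE => /leq_trans; apply.
by apply: leq_sum => i _; rewrite mnm_ext_z.
Qed.

Let slice_gradQ0 i j : slice j (N i) 0%MM = 0.
Proof.
rewrite slice_zderiv /= add0m -[Q _]/(slice j Q U_(i)%MM).
by rewrite Q_order ?mdeg1 ?mul0rn.
Qed.

Lemma inversion_burgers : fps_deriv ord_max Q *+ 2 = \sum_i zgrad Q i ^+ 2.
Proof.
apply/eqP; rewrite -subr_eq0; apply/eqP/slice_inj => j; rewrite linear0.
(* Integration in z, slice by slice: the difference has zero gradient and zero constant term. *)
apply: fps_deriv_eq0 => [k|].
  rewrite -slice_zderiv linearB linearMn /= fps_derivC gradQ_burgers.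
  rewrite linear_sum /= -sumrMnl -sumrB big1 ?linear0 // => i _.
  (* The gradients agree by symmetry of the Hessian of [Q]. *)
  by rewrite fps_derivX expr1 -mulrnBl /N /zgrad fps_derivC subrr mul0rn.
have dt0 : slice j (fps_deriv ord_max Q) 0%MM = 0.
  by rewrite slice_tderiv fps_coefMn Q_order ?mdeg0 // mul0rn.
have grad0 i : slice j (N i ^+ 2) 0%MM = 0.
  (* [slice j] is not multiplicative for j > 0, so the product is expanded; in every splitting of
     t^j the first exponent is free of z, where [N i] vanishes. *)
  rewrite expr2; apply: big1 => -[k1 k2] /= /eqP e.
  rewrite -(mnm_resK k1) -[X in X * _]/(slice _ (N i) _).
  have -> : mnm_res k1 = 0%MM; last by rewrite slice_gradQ0 mul0r.
  apply/mnmP => l; have := congr1 (fun a : 'X_{1..n.+1} => a (zidx l)) e.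
  rewrite mnm_ext_z mnmDE !mnm0E mnmE => /esym/eqP.
  by rewrite addn_eq0 => /andP[/eqP].
rewrite linearB linearMn linear_sum -[LHS]/(fpscoef _ _ - fpscoef _ _).
rewrite fps_coefMn dt0 mul0rn fps_coef_sum big1 ?subrr // => i _.
exact: grad0.
Qed.

(** At t = 0 the map [G] is the identity, so [gradQ] equates the gradients; both constant terms
    vanish. *)
Lemma inversion_slice0 : slice 0 Q = P.
Proof.
apply/eqP; rewrite -subr_eq0; apply/eqP; apply: fps_deriv_eq0 => [i|].
  rewrite linearB /= -slice_zderiv -[fps_deriv (zidx i) Q]/(N i) gradQ.
  rewrite fps_comp_slice0.
  rewrite (_ : (fun i => _) = @fps_var n K) ?fps_comp_id ?subrr //.
  apply: funext => j; rewrite /G linearD /= slice0_tvar addr0.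
  apply: fpsP => a /=; congr (_ %:R).
  by rewrite -mnm_ext_Uz (can_eq (fun a => mnm_extK a 0)).
rewrite -[LHS]/(slice 0 Q 0%MM - P 0%MM) Q_order ?mdeg0 //.
by rewrite (fps_coef_order oP) ?mdeg0 // subrr.
Qed.

(** Differentiating twice gives (k+1) Q^k Delta Q, which vanishes, plus k(k+1) Q^(k-1) <grad Q, grad
    Q>, to which [inversion_burgers] applies. *)
Lemma inversion_heat k :
  \sum_i fps_deriv (zidx i) (fps_deriv (zidx i) (Q ^+ k.+1)) =
    fps_deriv ord_max (Q ^+ k) *+ (2 * k.+1).
Proof.
under eq_bigr do rewrite fps_derivX linearMn /= fps_derivM fps_derivX.
rewrite sumrMnl big_split /= -mulr_sumr laplacian_inversion_eq0 mulr0 addr0.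
rewrite mulrnA; congr (_ *+ _); rewrite fps_derivX -mulrnA mulnC mulrnA.
rewrite -mulrnAr inversion_burgers mulr_sumr -sumrMnl.
by apply: eq_bigr => i _; rewrite expr2 mulrnAl mulrA.
Qed.

Lemma inversion_slice j k :
  slice j (Q ^+ k) = k`!%:R *:
    ((2%:R ^+ j * j`!%:R * (j + k)`!%:R)^-1 *:
       iter j (@laplacian n K) (P ^+ (j + k))).
Proof.
(* [k] stays general because the step for [j.+1] uses the exponent [k.+1]. *)
elim: j k => [|j IH] k.
  rewrite slice0X inversion_slice0 expr0 fact0 !mul1r scalerA divff ?scale1r //.
  by rewrite pnatr_eq0 -lt0n fact_gt0.
(* The coefficient of t^j in [inversion_heat]: differentiation in t gives the factor [j.+1], the
   identity itself [2 * k.+1]. *)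
have heat : slice j.+1 (Q ^+ k) *+ (j.+1 * (2 * k.+1)) =
    laplacian (slice j (Q ^+ k.+1)).
  rewrite /laplacian; under [RHS]eq_bigr do rewrite -!slice_zderiv.
  by rewrite -linear_sum inversion_heat linearMn /= slice_tderiv -mulrnA.
apply: (@scalerI _ _ (j.+1 * (2 * k.+1))%:R); first by rewrite pnatr_eq0.
rewrite [LHS]scaler_nat heat IH !linearZ /= addSnnS !scalerA; congr (_ *: _).
rewrite !factS !natrM exprS !invfM.
have nz i : i.+1%:R != 0 :> K by rewrite pnatr_eq0.
have fz i : i`!%:R != 0 :> K by rewrite pnatr_eq0 -lt0n fact_gt0.
have jn0 := nz j; have tj : 2%:R ^+ j != 0 :> K by rewrite expf_neq0.
move: (fz j) (fz (j + k.+1)%N) jn0 tj.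
move: j.+1%:R j`!%:R (j + k.+1)`!%:R (2%:R ^+ j) => a b c d b0 c0 a0 d0.
by field; rewrite a0 b0 c0 d0.
Qed.

End HessianNilpotent.

Theorem theorem3p4 (R : realType) (n : nat)
    (P : {fps R[i][n]}) (Q : {fps R[i][n.+1]})
    (oP : fps_order_ge 2 P)
    (hnP : hessian_nilpotent P)
    (PQ : deformed_inversion_pair P Q) :
  (forall k : nat, (1 <= k)%N ->
     exists2 S : {fps R[i][n.+1]},
       fps_has_sum
         (fun m : nat =>
            (2%:R ^+ m * m`!%:R * (m + k)`!%:R)^-1 *:
              (tvar ^+ m * fps_widen (iter m (@laplacian n R[i]) (P ^+ (m + k)))))
         S
       & Q ^+ k = k`!%:R *: S)
  /\
  (forall Qs : nat -> {fps R[i][n]},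
     fps_has_sum (fun m : nat => tvar ^+ m * fps_widen (Qs m.+1)) Q ->
     forall m : nat, (1 <= m)%N ->
       Qs m = (2%:R ^+ m.-1 * m`!%:R * (m.-1)`!%:R)^-1 *:
                iter m.-1 (@laplacian n R[i]) (P ^+ m)).
Proof.
have sliceQ := inversion_slice oP hnP PQ.
split=> [k _ | Qs /fps_has_sum_slice QsQ [//|m] _ /=].
  have k0 : k`!%:R != 0 :> R[i] by rewrite pnatr_eq0 -lt0n fact_gt0.
  (* The sum is taken to be Q^k / k!; moving the scalars into the z-coefficients lets convergence be
     checked on slices. *)
  exists (k`!%:R^-1 *: Q ^+ k); last by rewrite scalerA divff // scale1r.
  rewrite (_ : (fun m => _) = fun m => tvar ^+ m * fps_widen
    ((2%:R ^+ m * m`!%:R * (m + k)`!%:R)^-1 *: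
       iter m (@laplacian n R[i]) (P ^+ (m + k)))).
    by apply/fps_has_sum_slice => m; rewrite linearZ /= sliceQ scalerK.
  apply: funext => m; rewrite scalerAr; congr (_ * _); apply: slice_inj => j.
  rewrite linearZ /= !slice_widen; case: eqP => // _; exact: scaler0.
(* The case k = 1 of the slice formula: the coefficient of t^m is [Qs m.+1]. *)
have := QsQ m; rewrite -[Q in slice _ Q]expr1 sliceQ -[1`!]/1%N.
rewrite scale1r addn1 => <-.
by rewrite [X in X^-1 *: _]mulrAC.
Qed.
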